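(* For each constant $\delta>0$, with $n$ the number of vectors in each of the two input lists: (1) if $\#$QSETH holds, there is no bounded-error quantum algorithm that solves Count $\mathsf{OV}$ in $\mathcal{O}(n^{2-\delta})$ time; (2) if $\oplus$QSETH holds, there is no bounded-error quantum algorithm that solves Parity $\mathsf{OV}$ in $\mathcal{O}(n^{2-\delta})$ time; (3) if Majority-QSETH holds, there is no bounded-error quantum algorithm that solves strict-Majority $\mathsf{OV}$ in $\mathcal{O}(n^{2-\delta})$ time.
   Context: Inputs to the $\mathsf{OV}$ (Orthogonal Vectors) problems: two lists $A$ and $B$, each consisting of $n$ vectors from $\{0,1\}^d$. Let $d'$ be the number of pairs $(a,b)$, $a\in A$, $b\in B$, with $\langle a,b\rangle=0$. Count $\mathsf{OV}$: output $d'$. Parity $\mathsf{OV}$: output $d'\bmod 2$. strict-Majority $\mathsf{OV}$: output $1$ if $d'>n^2/2$ and $0$ otherwise. A bounded-error quantum algorithm outputs a correct answer with probability at least $2/3$ on every input. For a CNF formula $\phi$ on $n$ variables with $m$ clauses, $|\phi|$ is the number of satisfying assignments. Problems: $\#$CNFSAT (output $|\phi|$), $\oplus$CNFSAT (output $|\phi|\bmod2$), maj-CNFSAT (output $1$ iff $|\phi|\ge2^n/2$), st-maj-CNFSAT (output $1$ iff $|\phi|>2^n/2$). $\#$QSETH: for each constant $\delta>0$ there exists $c>0$ such that no bounded-error quantum algorithm solves $\#$CNFSAT (even restricted to $m\le cn^2$) in $\mathcal{O}(2^{n(1-\delta)})$ time. $\oplus$QSETH: the same statement for $\oplus$CNFSAT.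 Majority-QSETH: the same statement for maj-CNFSAT and for st-maj-CNFSAT. *)

(* Defs.v *)
From HB Require Import structures.
From mathcomp Require Import all_boot all_order all_algebra.
From mathcomp Require Import finmap.
From mathcomp Require Import complex.
From mathcomp Require Import reals exp.

Set Implicit Arguments.
Unset Strict Implicit.
Unset Printing Implicit Defensive.

Import Order.TTheory GRing.Theory Num.Theory.

(** A bounded-error quantum algorithm is a single finite program (the same one
    for all inputs) for a classical random-access machine that controls a
    quantum memory.  The classical part has scalar variables and arrays of
    natural numbers.  Its only arithmetic operations are successor and
    predecessor: after [t] steps every cell is at most the largest cell of the
    input or constant of the program plus [t], so that charging one unit per
    instruction does not allow computing with unreasonably long words.  Up to
    polylogarithmic factors this is the same time measure as that of the
    logarithmic-cost RAM.

    The quantum memory has qubits indexed by [nat], all initially |0>.  The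
    gates are Hadamard, T, CNOT (a universal set), the quantum random access
    gate, and measurement in the computational basis. *)

Definition var := nat.

Inductive test : Type :=
| TEq (x y : var)
| TLt (x y : var).

Inductive cmd : Type :=
| Skip
| Seq (c1 c2 : cmd)
| If (b : test) (c1 c2 : cmd)
| While (b : test) (c : cmd)
| Const (x : var) (k : nat)            (* x := k *)
| Copy (x y : var)                     (* x := y *)
| Succ (x : var)                       (* x := x + 1 *)
| Pred (x : var)                       (* x := x - 1, truncated at 0 *)
| Read (x : var) (a : nat) (y : var)   (* x := a[y] *)
| Write (a : nat) (y x : var)          (* a[y] := x *)
(* The variables below hold the indices of the qubits acted upon. *)
| Hadamard (q : var)
| Tgate (q : var)
| Cnot (q r : var)                     (* control q, target r *)
| Qrag (adr len tgt mem : var)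
| Measure (x q : var).                 (* x := outcome of measuring qubit q *)

Record store := Store { vars : var -> nat; arrs : nat -> nat -> nat }.

Definition upd (f : nat -> nat) (x v : nat) : nat -> nat :=
  fun y => if y == x then v else f y.

Definition set_var (s : store) (x : var) (v : nat) : store :=
  Store (upd (vars s) x v) (arrs s).

Definition set_arr (s : store) (a i v : nat) : store :=
  Store (vars s) (fun b => if b == a then upd (arrs s a) i v else arrs s b).

Definition eval_test (s : store) (b : test) : bool :=
  match b with
  | TEq x y => vars s x == vars s y
  | TLt x y => vars s x < vars s y
  end.

(** A computational basis state is the finite set of the qubits equal to 1. *)
Definition basis := {fset nat}.

Local Open Scope fset_scope.

Definition set_qubit (q : nat) (b : bool) (s : basis) : basis :=
  if b then q |` s else s `\ q.

Definition cnot_basis (q r : nat) (s : basis) : basis :=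
  if (q != r) && (q \in s) then set_qubit r (r \notin s) s else s.

Definition swap_basis (q r : nat) (s : basis) : basis :=
  set_qubit q (r \in s) (set_qubit r (q \in s) s).

(** Value (least significant bit first) of the [len] qubits from [adr] on. *)
Definition address (adr len : nat) (s : basis) : nat :=
  (\sum_(i < len) (adr + i \in s) * 2 ^ i)%N.

(** The quantum random access gate swaps qubit [tgt] with the qubit
    [mem + i], where [i] is the content of the [len] address qubits.  It acts
    trivially when this would touch an address qubit; hence it is an
    involution on basis states. *)
Definition qrag_basis (adr len tgt mem : nat) (s : basis) : basis :=
  let cell := (mem + address adr len s)%N in
  let in_adr q := (adr <= q < adr + len)%N in
  if in_adr tgt || in_adr cell then s else swap_basis tgt cell s.

Local Open Scope ring_scope.

Definition qstate (R : realType) := {fsfun basis -> R[i] with 0}.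

Definition isqrt2 (R : realType) : R := (Num.sqrt 2)^-1.

Definition qinit (R : realType) : qstate R :=
  [fsfun s in [fset (fset0 : basis)] => (1 : R[i])].

Definition normsq (R : realType) (z : R[i]) : R :=
  complex.Re z ^+ 2 + complex.Im z ^+ 2.

(** Squared norm.  States reached after a measurement are not renormalized, so
    that the mass of a branch is the probability that it is taken. *)
Definition mass (R : realType) (psi : qstate R) : R :=
  \sum_(s <- finsupp psi) normsq (psi s).

(** Linear extension of [f], which must be an involution. *)
Definition permute (R : realType) (f : basis -> basis) (psi : qstate R)
  : qstate R :=
  [fsfun s in [fset f t | t in finsupp psi] => psi (f s)].

Definition hadamard (R : realType) (q : nat) (psi : qstate R) : qstate R :=
  [fsfun s in [fset set_qubit q false t | t in finsupp psi]
              `|` [fset set_qubit q true t | t in finsupp psi]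
   => (isqrt2 R)%:C%C
      * (psi (set_qubit q false s)
         + (-1) ^+ (q \in s) * psi (set_qubit q true s))].

Definition tgate (R : realType) (q : nat) (psi : qstate R) : qstate R :=
  [fsfun s in finsupp psi
   => (if q \in s then Complex (isqrt2 R) (isqrt2 R) else 1) * psi s].

Definition project (R : realType) (q : nat) (b : bool) (psi : qstate R)
  : qstate R :=
  [fsfun s in finsupp psi => if (q \in s) == b then psi s else 0].

(** Configurations: the commands still to be executed, the classical store,
    the (subnormalized) quantum state, and the time elapsed so far. *)
Record config (R : realType) := Config {
  kont : seq cmd;
  st : store;
  qs : qstate R;
  clock : nat }.

(** Every command costs one unit of time, except that the quantum random
    access gate is also charged for its address qubits. *)
Definition cost (s : store) (c : cmd) : nat :=
  match c with
  | Qrag _ len _ _ => (vars s len).+1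
  | _ => 1%N
  end.

(** The list of successors has two elements for a measurement, and one
    otherwise. *)
Definition step (R : realType) (g : config R) : seq (config R) :=
  let: Config k s psi t := g in
  if k is c :: k' then
    let t' := (t + cost s c)%N in
    let go k'' := [:: Config k'' s psi t'] in
    let put s' := [:: Config k' s' psi t'] in
    let gate psi' := [:: Config k' s psi' t'] in
    let v := vars s in
    match c with
    | Skip => go k'
    | Seq c1 c2 => go [:: c1, c2 & k']
    | If b c1 c2 => go ((if eval_test s b then c1 else c2) :: k')
    | While b c1 => go (if eval_test s b then [:: c1, c & k'] else k')
    | Const x n => put (set_var s x n)
    | Copy x y => put (set_var s x (v y))
    | Succ x => put (set_var s x (v x).+1)
    | Pred x => put (set_var s x (v x).-1)
    | Read x a y => put (set_var s x (arrs s a (v y)))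
    | Write a y x => put (set_arr s a (v y) (v x))
    | Hadamard q => gate (hadamard (v q) psi)
    | Tgate q => gate (tgate (v q) psi)
    | Cnot q r => gate (permute (cnot_basis (v q) (v r)) psi)
    | Qrag a l q m => gate (permute (qrag_basis (v a) (v l) (v q) (v m)) psi)
    | Measure x q =>
        [seq Config k' (set_var s x (nat_of_bool b)) (project (v q) b psi) t'
        | b <- [:: false; true]]
    end
  else [:: g].

Definition run (R : realType) (t : nat) (g : config R) : seq (config R) :=
  iter t (fun gs => flatten [seq step h | h <- gs]) [:: g].

(** The input is in array 0; everything else is initially 0. *)
Definition init_store (input : seq nat) : store :=
  Store (fun=> 0%N) (fun a i => if a == 0%N then nth 0%N input i else 0%N).

Definition init (R : realType) (p : cmd) (input : seq nat) : config R :=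
  Config [:: p] (init_store input) (qinit R) 0.

(** The output is a number written in binary, least significant bit first, in
    array 1; the number of bits is the value of variable 0. *)
Definition output (s : store) : nat :=
  (\sum_(i < vars s 0) (arrs s 1 i != 0) * 2 ^ i)%N.

(** Probability that the program halts within time [t] with an output in [E];
    as each step costs at least one unit, [t] steps suffice. *)
Definition prob (R : realType) (p : cmd) (input : seq nat) (t : nat)
  (E : pred nat) : R :=
  \sum_(g <- run t (init R p input)
       | [&& nilp (kont g), (clock g <= t)%N & E (output (st g))]) mass (qs g).

Definition halts_within (R : realType) (p : cmd) (input : seq nat) (t : nat)
  : Prop := prob R p input t predT = 1.

Record problem := Problem {
  instance : Type;
  encode : instance -> seq nat;
  answer : instance -> nat }.

Arguments answer p _ : clear implicits.

Definition solves (R : realType) (p : cmd) (Q : problem)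
  (D : instance Q -> Prop) : Prop :=
  forall x, D x -> exists t : nat,
    halts_within R p (encode x) t
    /\ 2 / 3 <= prob R p (encode x) t (pred1 (answer Q x)).

(** On the instances satisfying [D], the running time is O(f(size)). *)
Definition runs_in_bigO (R : realType) (p : cmd) (Q : problem)
  (D : instance Q -> Prop) (size : instance Q -> nat) (f : nat -> R) : Prop :=
  exists (C : R) (n0 : nat), forall x, D x -> (n0 <= size x)%N ->
    exists t : nat, t%:R <= C * f (size x) /\ halts_within R p (encode x) t.

(** The literal [(i, true)] is the variable [i], and [(i, false)] its
    negation. *)
Record cnf := Cnf {
  cnf_vars : nat;
  cnf_size : nat;
  clauses : cnf_size.-tuple {set 'I_cnf_vars * bool} }.

Definition satisfies (phi : cnf) (a : {ffun 'I_(cnf_vars phi) -> bool}) : bool :=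
  [forall j : 'I_(cnf_size phi),
    [exists l in tnth (clauses phi) j, a l.1 == l.2]].

Definition num_sat (phi : cnf) : nat := #|[set a | @satisfies phi a]|.

Definition encode_clause (n : nat) (cl : {set 'I_n * bool}) : seq nat :=
  flatten [seq [:: nat_of_bool ((i, true) \in cl);
                   nat_of_bool ((i, false) \in cl)] | i <- enum 'I_n].

Definition encode_cnf (phi : cnf) : seq nat :=
  [:: cnf_vars phi, cnf_size phi
    & flatten [seq encode_clause cl | cl <- clauses phi]].

Definition count_CNFSAT := Problem encode_cnf num_sat.

Definition parity_CNFSAT := Problem encode_cnf (fun phi => (num_sat phi %% 2)%N).

Definition maj_CNFSAT := Problem encode_cnf
  (fun phi => nat_of_bool (2 ^ cnf_vars phi <= 2 * num_sat phi)%N).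

Definition st_maj_CNFSAT := Problem encode_cnf
  (fun phi => nat_of_bool (2 ^ cnf_vars phi < 2 * num_sat phi)%N).

(** The hypothesis that a CNF problem, with answers [ans], has no bounded-error
    quantum algorithm that runs in time O(2^(n(1 - delta))), even when it is
    restricted to at most [c * n ^ 2] clauses. *)
Definition QSETH_for (R : realType) (ans : cnf -> nat) : Prop :=
  forall delta : R, 0 < delta -> exists c : R, 0 < c /\
    let few_clauses (phi : cnf) :=
      (cnf_size phi)%:R <= c * (cnf_vars phi)%:R ^+ 2 in
    ~ exists p : cmd,
        solves R p (Q := Problem encode_cnf ans) few_clauses
        /\ runs_in_bigO p (Q := Problem encode_cnf ans) few_clauses cnf_vars
             (fun n => 2 `^ (n%:R * (1 - delta))).

Definition count_QSETH (R : realType) : Prop :=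
  QSETH_for R (answer count_CNFSAT).

Definition parity_QSETH (R : realType) : Prop :=
  QSETH_for R (answer parity_CNFSAT).

Definition majority_QSETH (R : realType) : Prop :=
  QSETH_for R (answer maj_CNFSAT) /\ QSETH_for R (answer st_maj_CNFSAT).

(** The vectors of the two lists are the rows of the two matrices. *)
Record ov := OV {
  ov_num : nat;
  ov_dim : nat;
  ov_A : 'M[bool]_(ov_num, ov_dim);
  ov_B : 'M[bool]_(ov_num, ov_dim) }.

Definition inner (n d : nat) (A B : 'M[bool]_(n, d)) (i j : 'I_n) : nat :=
  (\sum_(k < d) A i k * B j k)%N.

Definition num_orth (x : ov) : nat :=
  #|[set ij : 'I_(ov_num x) * 'I_(ov_num x)
    | inner (ov_A x) (ov_B x) ij.1 ij.2 == 0%N]|.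

Definition encode_mx (n d : nat) (A : 'M[bool]_(n, d)) : seq nat :=
  [seq nat_of_bool (A i k) | i <- enum 'I_n, k <- enum 'I_d].

Definition encode_ov (x : ov) : seq nat :=
  [:: ov_num x, ov_dim x & encode_mx (ov_A x) ++ encode_mx (ov_B x)].

Definition count_OV := Problem encode_ov num_orth.

Definition parity_OV := Problem encode_ov (fun x => (num_orth x %% 2)%N).

Definition st_maj_OV := Problem encode_ov
  (fun x => nat_of_bool (ov_num x ^ 2 < 2 * num_orth x)%N).

Definition polylog_dim (K : nat) (x : ov) : Prop :=
  (ov_dim x <= K * (trunc_log 2 (ov_num x)).+1 ^ K)%N.

(** The program [p] solves the given OV problem, on all instances, and its
    running time is O(n^(2 - delta)) for dimensions polylogarithmic in the
    number [n] of vectors.  A bound uniform in the dimension could not be met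
    for the trivial reason that the input must be read; the implied constant
    therefore depends on the polylogarithmic bound, but on nothing else. *)
Definition solves_OV_in_time (R : realType) (p : cmd) (ans : ov -> nat)
  (delta : R) : Prop :=
  solves R p (Q := Problem encode_ov ans) (fun=> True)
  /\ forall K : nat,
       runs_in_bigO p (Q := Problem encode_ov ans) (polylog_dim K) ov_num
         (fun n => n%:R `^ (2 - delta)).

(* Main.v *)
Require Import Defs.
From mathcomp Require Import all_boot all_order all_algebra.
From mathcomp Require Import boolp reals exp.
From mathcomp Require Import zify ring lra.
From Stdlib Require List.

Set Implicit Arguments.
Unset Strict Implicit.
Unset Printing Implicit Defensive.

Import Order.TTheory GRing.Theory Num.Theory.

(** Split the [n] variables of a CNF into two halves of at most [h = ceil(n/2)]
    variables.  To a partial assignment of either half associate the vector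
    whose [j]-th entry says that no literal of clause [j] is satisfied; two
    vectors are orthogonal iff the union of the assignments satisfies the CNF.
    This gives two lists of [2 ^ h] vectors of dimension [m + 1].  For odd [n]
    the second half contains a dummy variable; the last coordinate either
    forces it to be false, so that the number of orthogonal pairs is exactly
    the number of satisfying assignments (counting and parity), or is constantly
    zero, so that both sides of the comparison are doubled (majority).

    The lists are produced in time [2 ^ (n/2)] up to a polynomial by a binary
    counter, in variables and arrays that the given program for OV does not
    mention; a run of that program from the resulting store is a run from its
    own initial store. *)

(** * Deterministic classical execution and renaming of registers *)

Notation "c ;; d" := (Seq c d) (at level 61, right associativity).

(** Big-step semantics of the classical commands from which the preprocessing is built. The last
    index is the exact number of machine steps, so that unfolding a sequence, a branch or a loop
    also counts one. *)
Inductive exec : cmd -> store -> store -> nat -> Prop :=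
| exec_skip s : exec Skip s s 1
| exec_seq c d s1 s2 s3 t1 t2 :
    exec c s1 s2 t1 -> exec d s2 s3 t2 -> exec (c ;; d) s1 s3 (t1 + t2).+1
| exec_if b c d s s' t :
    exec (if eval_test s b then c else d) s s' t -> exec (If b c d) s s' t.+1
| exec_while_true b c s1 s2 s3 t1 t2 :
    eval_test s1 b -> exec c s1 s2 t1 -> exec (While b c) s2 s3 t2 ->
    exec (While b c) s1 s3 (t1 + t2).+1
| exec_while_false b c s : ~~ eval_test s b -> exec (While b c) s s 1
| exec_const x k s : exec (Const x k) s (set_var s x k) 1
| exec_copy x y s : exec (Copy x y) s (set_var s x (vars s y)) 1
| exec_succ x s : exec (Succ x) s (set_var s x (vars s x).+1) 1
| exec_read x a y s : exec (Read x a y) s (set_var s x (arrs s a (vars s y))) 1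
| exec_write a y x s :
    exec (Write a y x) s (set_arr s a (vars s y) (vars s x)) 1.

Definition run_all (R : realType) (t : nat) (gs : seq (config R)) :=
  iter t (fun gs => flatten [seq step h | h <- gs]) gs.

Lemma run_all_add (R : realType) t u (gs : seq (config R)) :
  run_all (t + u) gs = run_all u (run_all t gs).
Proof. by rewrite /run_all addnC iterD. Qed.

Definition rename_test (V : nat) (b : test) : test :=
  match b with
  | TEq x y => TEq (V + x) (V + y)
  | TLt x y => TLt (V + x) (V + y)
  end.

(* Array 0, which holds the input, is the only one that stays in place. *)
Definition rename_arr (A a : nat) : nat := if a is a'.+1 then A + a' else 0.

Fixpoint rename (V A : nat) (c : cmd) : cmd :=
  match c with
  | c ;; d => rename V A c ;; rename V A d
  | If b c d => If (rename_test V b) (rename V A c) (rename V A d)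
  | While b c => While (rename_test V b) (rename V A c)
  | Const x k => Const (V + x) k
  | Copy x y => Copy (V + x) (V + y)
  | Succ x => Succ (V + x)
  | Read x a y => Read (V + x) (rename_arr A a) (V + y)
  | Write a y x => Write (rename_arr A a) (V + y) (V + x)
  | _ => c
  end.

(** The clauses on variables below [V] and on arrays strictly between 0 and [A] say that they are
    still in their initial state, ready for the OV program that runs afterwards. *)
Definition embeds (V A : nat) (r s : store) : Prop :=
  [/\ forall x, x < V -> vars s x = 0,
      forall x, vars s (V + x) = vars r x,
      forall a i, 0 < a < A -> arrs s a i = 0
    & forall a i, arrs s (rename_arr A a) i = arrs r a i].

Lemma embeds_init V A input : 0 < A ->
  embeds V A (init_store input) (init_store input).
Proof.
by move=> A0; split=> //= [[|a] i|[|a] i] //=; case: A A0.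
Qed.

Lemma embeds_set_var V A r s x v :
  embeds V A r s -> embeds V A (set_var r x v) (set_var s (V + x) v).
Proof.
move=> [lo va la ar]; split=> //= y; rewrite /upd.
  by move=> yV; case: eqP => [E|_]; [lia|exact: lo].
by rewrite eqn_add2l va.
Qed.

Lemma embeds_set_arr V A r s a i v : 0 < A ->
  embeds V A r s -> embeds V A (set_arr r a i v) (set_arr s (rename_arr A a) i v).
Proof.
move=> A0 [lo va la ar]; split=> //= b j; rewrite /upd.
  move=> bA; case: eqP => [E|_]; last exact: la.
  by case: a E => [|a] /= ?; lia.
have -> : (rename_arr A b == rename_arr A a) = (b == a).
  by case: a b => [|a] [|b] //=; rewrite ?eqn_add2l //; case: A A0 {lo va la ar}.
by case: eqP => _; rewrite ?ar // -ar.
Qed.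

Lemma embeds_test V A r s b :
  embeds V A r s -> eval_test s (rename_test V b) = eval_test r b.
Proof. by move=> [_ va _ _]; case: b => x y /=; rewrite !va. Qed.

(** Induction on the execution: every command of [exec] has a single successor, costs one unit and
    leaves the quantum state alone, so the number of steps and the advance of the clock coincide. *)
Lemma run_rename (R : realType) V A c r r' t : 0 < A -> exec c r r' t ->
  forall s, embeds V A r s -> exists2 s', embeds V A r' s' &
    forall k (psi : qstate R) t0,
      run_all t [:: Config (rename V A c :: k) s psi t0]
      = [:: Config k s' psi (t0 + t)].
Proof.
move=> A0; elim=> {c r r' t}.
- by move=> r s E; exists s => // k psi t0.
- move=> c d r1 r2 r3 t1 t2 _ IH1 _ IH2 s /IH1[s2 /IH2[s3 E H2] H1].
  exists s3 => // k psi t0.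
  rewrite -add1n run_all_add /= run_all_add H1 H2.
  by congr [:: Config _ _ _ _]; rewrite /=; lia.
- move=> b c d r r' t _ IH s E; have [s' E' H] := IH _ E.
  exists s' => // k psi t0.
  rewrite -add1n run_all_add /= (embeds_test _ E).
  have {}H := H k psi (t0 + 1).
  by case: ifP H => _ ->; congr [:: Config _ _ _ _]; lia.
- move=> b c r1 r2 r3 t1 t2 tb _ IH1 _ IH2 s E.
  have [s2 /IH2[s3 E3 H2] H1] := IH1 _ E.
  exists s3 => // k psi t0.
  rewrite -add1n run_all_add /= (embeds_test _ E) tb run_all_add H1 H2.
  by congr [:: Config _ _ _ _]; rewrite /=; lia.
- move=> b c r tb s E; exists s => // k psi t0.
  by rewrite /= (embeds_test _ E) (negbTE tb).
- by move=> x k r s E; eexists; first exact: embeds_set_var E.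
- move=> x y r s E; eexists; first exact: embeds_set_var E.
  by case: E => _ va _ _ k psi t0; rewrite /= va.
- move=> x r s E; eexists; first exact: embeds_set_var E.
  by case: E => _ va _ _ k psi t0; rewrite /= va.
- move=> x a y r s E; eexists; first exact: embeds_set_var E.
  by case: E => _ va _ ar k psi t0; rewrite /= va ar.
- move=> a y x r s E; eexists; first exact: embeds_set_arr E.
  by case: E => _ va _ _ k psi t0; rewrite /= !va.
Qed.

(** * Simulation of a program from an agreeing store *)

Definition test_below (V : nat) (b : test) : bool :=
  match b with TEq x y | TLt x y => (x < V) && (y < V) end.

Fixpoint below (V A : nat) (c : cmd) : bool :=
  match c with
  | Skip => true
  | c ;; d => below V A c && below V A d
  | If b c d => [&& test_below V b, below V A c & below V A d]
  | While b c => test_below V b && below V A c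
  | Const x _ | Succ x | Pred x | Hadamard x | Tgate x => x < V
  | Copy x y | Cnot x y | Measure x y => (x < V) && (y < V)
  | Read x a y | Write a x y => [&& x < V, a < A & y < V]
  | Qrag a l q m => [&& a < V, l < V, q < V & m < V]
  end.

Lemma test_belowW V V' b : V <= V' -> test_below V b -> test_below V' b.
Proof. by case: b => x y /= ? /andP[? ?]; apply/andP; split; lia. Qed.

Lemma belowW V V' A A' c : V <= V' -> A <= A' -> below V A c -> below V' A' c.
Proof.
move=> VV AA; elim: c => //=.
- by move=> c IHc d IHd /andP[/IHc-> /IHd].
- by move=> b c IHc d IHd /and3P[/(test_belowW VV)-> /IHc-> /IHd].
- by move=> b c IHc /andP[/(test_belowW VV)-> /IHc].
all: intros; lia.
Qed.

Lemma ex_below c : exists n, below n n c.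
Proof.
have mx n p : n <= maxn n p /\ p <= maxn n p by lia.
have tb b : exists n, test_below n b.
  by case: b => x y; exists (maxn x y).+1 => /=; lia.
elim: c; first by exists 0.
- move=> c [n cn] d [p dp]; exists (maxn n p) => /=; have [? ?] := mx n p.
  by rewrite (belowW _ _ cn) // (belowW _ _ dp).
- move=> b c [n cn] d [p dp]; have [q bq] := tb b.
  exists (maxn q (maxn n p)) => /=; have [? ?] := mx n p; have [? ?] := mx q (maxn n p).
  by rewrite (test_belowW _ bq) // (belowW _ _ cn) ?(belowW _ _ dp) //; lia.
- move=> b c [n cn]; have [q bq] := tb b.
  exists (maxn q n) => /=; have [? ?] := mx q n.
  by rewrite (test_belowW _ bq) // (belowW _ _ cn).
- by move=> x k; exists x.+1 => /=.
- by move=> x y; exists (maxn x y).+1 => /=; lia.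
- by move=> x; exists x.+1 => /=.
- by move=> x; exists x.+1 => /=.
- by move=> x y z; exists (maxn x (maxn y z)).+1 => /=; lia.
- by move=> x y z; exists (maxn x (maxn y z)).+1 => /=; lia.
- by move=> x; exists x.+1 => /=.
- by move=> x; exists x.+1 => /=.
- by move=> x y; exists (maxn x y).+1 => /=; lia.
- by move=> x y z u; exists (maxn (maxn u x) (maxn y z)).+1 => /=; lia.
- by move=> x y; exists (maxn x y).+1 => /=; lia.
Qed.

Definition agree (V A : nat) (r s : store) : Prop :=
  (forall x, x < V -> vars s x = vars r x)
  /\ (forall a i, a < A -> arrs s a i = arrs r a i).

Definition sim (R : realType) (V A T : nat) (g h : config R) : Prop :=
  [/\ kont h = kont g, all (below V A) (kont g), agree V A (st g) (st h),
      qs h = qs g & clock h = T + clock g].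

Lemma agree_set_var V A r s x v :
  agree V A r s -> agree V A (set_var r x v) (set_var s x v).
Proof.
move=> [va ar]; split=> //= y yV; rewrite /upd.
by case: eqP => // _; exact: va.
Qed.

Lemma agree_set_arr V A r s a i v :
  agree V A r s -> agree V A (set_arr r a i v) (set_arr s a i v).
Proof.
move=> [va ar]; split=> //= b j bA; rewrite /upd.
by case: eqP => // [<-|_]; rewrite ?ar.
Qed.

Lemma agree_test V A r s b :
  agree V A r s -> test_below V b -> eval_test s b = eval_test r b.
Proof. by move=> [va _]; case: b => x y /= /andP[? ?]; rewrite !va. Qed.

(** Equal continuations give successor lists of equal length, with two entries only at a
    measurement. Hence the relation is carried pointwise, and the branches keep equal masses. *)
Lemma sim_step (R : realType) V A T (g h : config R) :
  sim V A T g h -> List.Forall2 (sim V A T) (step g) (step h).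
Proof.
case: g h => [k r psi t] [_ s _ _] [/= -> + E -> ->].
have [va ar] := E.
case: k => [|c k] /=.
  by move=> _; apply: List.Forall2_cons; [split | exact: List.Forall2_nil].
case/andP=> cb kb.
have one k' r' s' (psi' : qstate R) u u' : all (below V A) k' -> agree V A r' s' ->
    u = u' ->
    List.Forall2 (sim V A T) [:: Config k' r' psi' (t + u)]
                             [:: Config k' s' psi' (T + t + u')].
  move=> bk' E' <-; apply: List.Forall2_cons; last exact: List.Forall2_nil.
  by split=> //=; rewrite addnA.
case: c cb => //=; intros; try apply: one => //=;
  repeat match goal with H : is_true (_ && _) |- _ => case/andP: H => ? ? end;
  rewrite ?va ?ar //; try by [apply: agree_set_var | apply: agree_set_arr | apply: one].
- by apply/and3P.
- by rewrite (agree_test E) //; apply: one => //=; case: ifP => _; rewrite kb andbT.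
- rewrite (agree_test E) //; apply: one => //; case: ifP => _ //=.
  by apply/and3P; split=> //; apply/andP.
- by do 2 (apply: List.Forall2_cons;
    first by split=> //=; [exact: agree_set_var | rewrite addnA]).
Qed.

Lemma sim_run (R : realType) V A T t (gs hs : seq (config R)) :
  List.Forall2 (sim V A T) gs hs ->
  List.Forall2 (sim V A T) (run_all t gs) (run_all t hs).
Proof.
move=> E; elim: t => [//|t]; rewrite /run_all /=.
elim=> {gs hs E} [|g h gs hs gh _ IH]; first by constructor.
exact: List.Forall2_app (sim_step gh) IH.
Qed.

Lemma sim_output V A r s :
  0 < V -> 1 < A -> agree V A r s -> output s = output r.
Proof.
move=> V0 A1 [va ar]; rewrite /output va //.
by apply: eq_bigr => i _; rewrite ar.
Qed.

(** The number of steps and the time limit are both shifted by [T], so corresponding branches are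
    counted on both sides with the same mass. The bounds on [V] and [A] keep the output registers,
    variable 0 and array 1, in the part where the stores agree. *)
Lemma prob_sim (R : realType) V A T t (p q : cmd) input input' (h : config R) E :
  0 < V -> 1 < A ->
  run T (init R q input') = [:: h] -> sim V A T (init R p input) h ->
  prob R q input' (T + t) E = prob R p input t E.
Proof.
move=> V0 A1 runq gh; rewrite /prob.
rewrite -[run (T + t) _]/(run_all (T + t) [:: init R q input']).
rewrite run_all_add -/(run T _) [run_all T _]runq.
have : List.Forall2 (sim V A T) (run t (init R p input)) (run_all t [:: h]).
  exact/sim_run/(List.Forall2_cons _ _ gh)/List.Forall2_nil.
elim=> [|g' h' gs hs [k _ ag ps ck] _ IH].
  by rewrite !big_nil.
by rewrite !big_cons k ck leq_add2l (sim_output V0 A1 ag) ps IH.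
Qed.

(** * Program logic with running time *)

Definition wp (c : cmd) (Q : store -> nat -> Prop) (s : store) (t : nat) : Prop :=
  exists s' u, exec c s s' u /\ Q s' (t + u).

Lemma wp_skip Q s t : Q s t.+1 -> wp Skip Q s t.
Proof. by exists s, 1; rewrite addn1; split=> //; exact: exec_skip. Qed.

Lemma wp_seq c d Q s t : wp c (wp d Q) s t.+1 -> wp (c ;; d) Q s t.
Proof.
move=> [s1 [t1 [E1 [s2 [t2 [E2 q]]]]]]; exists s2, (t1 + t2).+1.
by split; [exact: exec_seq E1 E2 | rewrite addnS -!addSn addnA].
Qed.

Lemma wp_if b c d Q s t :
  wp (if eval_test s b then c else d) Q s t.+1 -> wp (If b c d) Q s t.
Proof.
move=> [s1 [t1 [E q]]]; exists s1, t1.+1.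
by split; [exact: exec_if E | rewrite addnS -addSn].
Qed.

(** The time argument is the time already spent, so a bound on it can be part of the invariant.
    Fixing the number [N] of rounds in advance gives termination, by induction on the rounds that
    remain. *)
Lemma wp_while b c Q (I : nat -> store -> nat -> Prop) N s t :
  (forall i s t, i < N -> I i s t ->
     eval_test s b /\ wp c (I i.+1) s t.+1) ->
  (forall s t, I N s t -> ~~ eval_test s b /\ Q s t.+1) ->
  I 0 s t -> wp (While b c) Q s t.
Proof.
move=> body final.
suff H k : forall i s t, i + k = N -> I i s t -> wp (While b c) Q s t by exact: H.
elim: k => {s t} [|k IH] i s t iN.
  move: iN; rewrite addn0 => -> /final[tb q]; exists s, 1; rewrite addn1.
  by split=> //; exact: exec_while_false.
move=> /body[|tb [s1 [t1 [E1 q]]]]; first by lia.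
have [|s2 [t2 [E2 q2]]] := IH _ s1 (t.+1 + t1) _ q; first by lia.
exists s2, (t1 + t2).+1.
by split; [exact: exec_while_true E1 E2 | rewrite addnS -!addSn addnA].
Qed.

Definition three_arrs (f0 f1 f2 : nat -> nat) (a : nat) : nat -> nat :=
  match a with 0 => f0 | 1 => f1 | 2 => f2 | _ => fun=> 0 end.

Definition mk (l : seq nat) (f0 f1 f2 : nat -> nat) : store :=
  Store (nth 0 l) (three_arrs f0 f1 f2).

Definition test_on (l : seq nat) (b : test) : bool :=
  match b with
  | TEq x y => nth 0 l x == nth 0 l y
  | TLt x y => nth 0 l x < nth 0 l y
  end.

Lemma eval_test_mk l f0 f1 f2 b : eval_test (mk l f0 f1 f2) b = test_on l b.
Proof. by case: b. Qed.

Lemma set_var_mk l f0 f1 f2 x v :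
  set_var (mk l f0 f1 f2) x v = mk (set_nth 0 l x v) f0 f1 f2.
Proof.
by rewrite /set_var /mk /=; congr Store; apply: funext => y; rewrite nth_set_nth.
Qed.

Lemma wp_const x k Q l f0 f1 f2 t :
  Q (mk (set_nth 0 l x k) f0 f1 f2) t.+1 -> wp (Const x k) Q (mk l f0 f1 f2) t.
Proof.
by move=> q; eexists _, 1; split; [exact: exec_const | rewrite addn1 set_var_mk].
Qed.

Lemma wp_copy x y Q l f0 f1 f2 t :
  Q (mk (set_nth 0 l x (nth 0 l y)) f0 f1 f2) t.+1 ->
  wp (Copy x y) Q (mk l f0 f1 f2) t.
Proof.
by move=> q; eexists _, 1; split; [exact: exec_copy | rewrite addn1 set_var_mk].
Qed.

Lemma wp_succ x Q l f0 f1 f2 t :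
  Q (mk (set_nth 0 l x (nth 0 l x).+1) f0 f1 f2) t.+1 ->
  wp (Succ x) Q (mk l f0 f1 f2) t.
Proof.
by move=> q; eexists _, 1; split; [exact: exec_succ | rewrite addn1 set_var_mk].
Qed.

Lemma wp_read x a y Q l f0 f1 f2 t :
  Q (mk (set_nth 0 l x (three_arrs f0 f1 f2 a (nth 0 l y))) f0 f1 f2) t.+1 ->
  wp (Read x a y) Q (mk l f0 f1 f2) t.
Proof.
by move=> q; eexists _, 1; split; [exact: exec_read | rewrite addn1 set_var_mk].
Qed.

Lemma wp_write0 y x Q l f0 f1 f2 t :
  Q (mk l (upd f0 (nth 0 l y) (nth 0 l x)) f1 f2) t.+1 ->
  wp (Write 0 y x) Q (mk l f0 f1 f2) t.
Proof.
move=> q; eexists _, 1; split; first exact: exec_write.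
rewrite addn1; congr Q: q; rewrite /set_arr /mk; congr Store.
by apply: funext; case=> [|[|[|]]].
Qed.

Lemma wp_write1 y x Q l f0 f1 f2 t :
  Q (mk l f0 (upd f1 (nth 0 l y) (nth 0 l x)) f2) t.+1 ->
  wp (Write 1 y x) Q (mk l f0 f1 f2) t.
Proof.
move=> q; eexists _, 1; split; first exact: exec_write.
rewrite addn1; congr Q: q; rewrite /set_arr /mk; congr Store.
by apply: funext; case=> [|[|[|]]].
Qed.

Lemma wp_write2 y x Q l f0 f1 f2 t :
  Q (mk l f0 f1 (upd f2 (nth 0 l y) (nth 0 l x))) t.+1 ->
  wp (Write 2 y x) Q (mk l f0 f1 f2) t.
Proof.
move=> q; eexists _, 1; split; first exact: exec_write.
rewrite addn1; congr Q: q; rewrite /set_arr /mk; congr Store.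
by apply: funext; case=> [|[|[|]]].
Qed.

Ltac wp_step := first
  [ apply: wp_seq | apply: wp_const | apply: wp_copy | apply: wp_succ
  | apply: wp_read | apply: wp_write0 | apply: wp_write1 | apply: wp_write2
  | apply: wp_skip ]; cbn [set_nth nth three_arrs].

Ltac wp_run := repeat first
  [ wp_step | apply: wp_if; rewrite eval_test_mk; cbn [test_on nth]; case: ifP => ? ].

(* Variables: 0 zero, 1 one, 2 number n of CNF variables, 3 number m of clauses,
   4 half h = ceil(n/2), 5 its double, 6 and 7 the range lo, hi of CNF variables
   assigned by the current list, 8 loop index v, 9 loop index j, 10 read
   position p, 11 write position w, 12 entry u to be written, 13 and 14 scratch,
   15 carry, 16 number k of vectors.  Array 1 is the current partial assignment,
   with value 2 for the unassigned CNF variables; array 2 is the output.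
   Entry n of array 1 belongs to the dummy variable if n is odd, and is 0
   throughout if n is even, so that the last coordinate has no effect then. *)
Definition lit_step : cmd :=
  Read 14 1 8 ;;
  Read 13 0 10 ;;
  If (TEq 13 1) (If (TEq 14 1) (Const 12 0) Skip) Skip ;;
  Succ 10 ;;
  Read 13 0 10 ;;
  If (TEq 13 1) (If (TEq 14 0) (Const 12 0) Skip) Skip ;;
  Succ 10 ;;
  Succ 8.

Definition clause_step : cmd :=
  Const 12 1 ;;
  Const 8 0 ;;
  While (TLt 8 2) lit_step ;;
  Write 2 11 12 ;;
  Succ 11 ;;
  Succ 9.

Definition emit (f : bool) : cmd :=
  Const 10 2 ;;
  Const 9 0 ;;
  While (TLt 9 3) clause_step ;;
  Const 12 f ;;
  Read 14 1 2 ;;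
  If (TEq 14 0) (Const 12 0) Skip ;;
  Write 2 11 12 ;;
  Succ 11.

(** Ripple-carry increment: a digit 1 becomes 0 and passes the carry on, a digit 0 becomes 1 and
    absorbs it. A carry surviving the last digit signals overflow and ends the loop of
    [emit_list]. *)
Definition incr_step : cmd :=
  If (TEq 15 1)
    (Read 13 1 8 ;; If (TEq 13 1) (Write 1 8 0) (Write 1 8 1 ;; Const 15 0))
    Skip ;;
  Succ 8.

Definition incr : cmd :=
  Const 15 1 ;; Copy 8 6 ;; While (TLt 8 7) incr_step.

Definition emit_list (f : bool) : cmd :=
  Const 16 0 ;; Const 15 0 ;;
  While (TEq 15 0) (emit f ;; Succ 16 ;; incr).

Definition fill : cmd := Write 1 8 13 ;; Succ 8.

(** The first loop advances one counter by two and another by one, which yields [ceil(n/2)] and its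
    double using successors only. The vectors are built in array 2 and copied to array 0 at the end,
    because the formula in array 0 is read again for every vector. *)
Definition prep (f : bool) : cmd :=
  Const 1 1 ;; Read 2 0 0 ;; Read 3 0 1 ;;
  While (TLt 8 2) (Succ 8 ;; Succ 4 ;; Succ 8) ;;
  Copy 5 8 ;; Const 11 2 ;;
  Copy 8 4 ;; Const 13 2 ;; While (TLt 8 5) fill ;;
  Const 6 0 ;; Copy 7 4 ;; emit_list f ;;
  Const 8 0 ;; Const 13 2 ;; While (TLt 8 4) fill ;;
  Const 13 0 ;; While (TLt 8 5) fill ;;
  Copy 6 4 ;; Copy 7 5 ;; emit_list f ;;
  Write 2 0 16 ;; Succ 3 ;; Write 2 1 3 ;;
  Const 8 0 ;; While (TLt 8 11) (Read 13 2 8 ;; Write 0 8 13 ;; Succ 8).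

(** * Correctness and running time of the preprocessing *)

Definition stt n m h lo hi v j p w u x y c k :
    (nat -> nat) -> (nat -> nat) -> (nat -> nat) -> store :=
  mk [:: 0; 1; n; m; h; h.*2; lo; hi; v; j; p; w; u; x; y; c; k].

(** Cells [p + 2v] and [p + 2v + 1] hold the membership bits of the positive and the negative
    literal of [v]. The value 2 of an unassigned variable satisfies neither. *)
Definition satisfied_by (inp g : nat -> nat) (p v : nat) : bool :=
  (inp (p + v.*2) == 1) && (g v == 1) || (inp (p + v.*2).+1 == 1) && (g v == 0).

Definition unsat (inp g : nat -> nat) (n p : nat) : bool :=
  ~~ has (satisfied_by inp g p) (iota 0 n).

Lemma wp_lits Q n m h lo hi j p w x y c k inp g out t :
  (forall x y t', t' <= t + n * 30 + 1 ->
     Q (stt n m h lo hi n j (p + n.*2) w (unsat inp g n p) x y c k inp g out) t') ->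
  wp (While (TLt 8 2) lit_step) Q
    (stt n m h lo hi 0 j p w 1 x y c k inp g out) t.
Proof.
move=> q.
apply: (wp_while (N := n) (I := fun i s t' => t' <= t + i * 30 /\ exists x y,
  s = stt n m h lo hi i j (p + i.*2) w (unsat inp g i p) x y c k inp g out)).
- move=> i s t1 ltin [le_t [x1 [y1 ->]]]; split; first by rewrite eval_test_mk /= ltin.
  have -> : unsat inp g i.+1 p = unsat inp g i p && ~~ satisfied_by inp g p i.
    by rewrite /unsat -addn1 iotaD has_cat /= orbF negb_or.
  rewrite /satisfied_by /stt doubleS 2!(addnS p).
  wp_run; (split; [by lia | do 2 eexists]);
    repeat match goal with H : _ = _ :> bool |- _ => rewrite ?H; clear H end;
    rewrite /= ?andbT ?andbF ?orbT //.
- move=> s t1 [le_t [x1 [y1 ->]]]; split; first by rewrite eval_test_mk /= ltnn.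
  by apply: q; lia.
- by split; [lia|exists x, y; rewrite /= addn0].
Qed.

Definition put (f : nat -> nat) (w : nat) (l : seq nat) : nat -> nat :=
  fun k => if w <= k < w + size l then nth 0 l (k - w) else f k.

Lemma put0 f w : put f w [::] = f.
Proof. by apply: funext => k; rewrite /put addn0; case: ifP => //; lia. Qed.

Lemma put_cat f w l1 l2 : put (put f w l1) (w + size l1) l2 = put f w (l1 ++ l2).
Proof.
apply: funext => k; rewrite /put size_cat nth_cat subnDA.
by repeat case: ifP => ? //; lia.
Qed.

Lemma upd_put f w l x : upd (put f w l) (w + size l) x = put f w (rcons l x).
Proof.
rewrite -cats1 -put_cat; apply: funext => k; rewrite /upd /put /= addn1 ltnS.
by rewrite -eqn_leq eq_sym; case: eqP => // ->; rewrite subnn.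
Qed.

Definition ov_row (inp g : nat -> nat) (n m : nat) (f : bool) : seq nat :=
  rcons [seq nat_of_bool (unsat inp g n (2 + (n * j).*2)) | j <- iota 0 m]
        (f && (g n != 0)).

Lemma wp_emit f Q n m h lo hi v j p w u x y c k inp g out t :
  (forall v j p u x y t', t' <= t + (m * (n * 30 + 20) + 20) ->
     Q (stt n m h lo hi v j p (w + m.+1) u x y c k inp g
          (put out w (ov_row inp g n m f))) t') ->
  wp (emit f) Q (stt n m h lo hi v j p w u x y c k inp g out) t.
Proof.
move=> q; rewrite /stt /emit; do 5 wp_step.
apply: (wp_while (N := m) (I := fun i s t' =>
  t' <= t + i * (n * 30 + 20) + 5 /\ exists v u x y,
  s = stt n m h lo hi v i (2 + (n * i).*2) (w + i) u x y c k inp g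
    (put out w [seq nat_of_bool (unsat inp g n (2 + (n * j).*2)) | j <- iota 0 i]))).
- move=> i s t1 im [le_t [v1 [u1 [x1 [y1 ->]]]]].
  split; first by rewrite eval_test_mk /= im.
  rewrite /stt /clause_step; do 5 wp_step.
  apply: wp_lits => x2 y2 t2 le_t2; rewrite /stt; wp_run.
  split; first by lia.
  exists n, (unsat inp g n (2 + (n * i).*2)), x2, y2.
  rewrite /stt; congr mk; first by rewrite mulnS doubleD addnAC -addnA addnS.
  rewrite -[in iota 0 i.+1](addn1 i) iotaD map_cat cats1 -upd_put size_map size_iota.
  by [].
- move=> s t1 [le_t [v1 [u1 [x1 [y1 ->]]]]].
  split; first by rewrite eval_test_mk /= ltnn.
  rewrite /stt.
  have step z t' : t' <= t + (m * (n * 30 + 20) + 20) -> z = (f && (g n != 0)) ->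
    Q (mk [:: 0; 1; n; m; h; h.*2; lo; hi; v1; m; 2 + (n * m).*2; (w + m).+1;
           nat_of_bool z; x1; g n; c; k] inp g
       (upd (put out w [seq nat_of_bool (unsat inp g n (2 + (n * j).*2)) | j <- iota 0 m])
         (w + m) z)) t'.
    move=> le_t' ->.
    have := q v1 m (2 + (n * m).*2) (f && (g n != 0)) x1 (g n) _ le_t'.
    by rewrite /stt /ov_row -upd_put size_map size_iota addnS.
  wp_run; [apply: (step false) | apply: (step f)]; try lia.
- by split; [lia | exists v, u, x, y; rewrite /stt muln0 addn0 put0].
Qed.

(** * The binary counter and the enumeration of the vectors *)

Definition bit (i u : nat) : bool := odd (i %/ 2 ^ u).

(** The quotient of [i] by [2 ^ u] grows by one exactly when [2 ^ u] divides [i + 1]; this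
    divisibility is the carry into position [u]. *)
Lemma bitS i u : bit i.+1 u = bit i u (+) (2 ^ u %| i.+1).
Proof. by rewrite /bit divnS ?expn_gt0 // oddD addbC; case: (_ %| _). Qed.

(** This is the propagation of the carry. When [2 ^ u] divides [i + 1], the quotient is even iff the
    new bit is 0, that is, iff the old bit was 1. *)
Lemma dvdn_exp2S i u : (2 ^ u.+1 %| i.+1) = (2 ^ u %| i.+1) && bit i u.
Proof.
case: (boolP (2 ^ u %| i.+1)) => [d|nd] /=; last first.
  by apply: contraNF nd; apply: dvdn_trans; rewrite expnS dvdn_mull.
rewrite expnS -dvdn_divRL // dvdn2.
by have := bitS i u; rewrite /bit d addbT => ->; rewrite negbK.
Qed.

Definition asg (lo h i : nat) : nat -> nat :=
  fun v => if lo <= v < lo + h then nat_of_bool (bit i (v - lo))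
           else if v < h.*2 then 2 else 0.

Lemma asg_period lo h : asg lo h (2 ^ h) = asg lo h 0.
Proof.
apply: funext => v; rewrite /asg; case: ifP => // lov; congr nat_of_bool.
rewrite /bit div0n -(@subnK (v - lo) h); last by lia.
by rewrite expnD mulnK ?expn_gt0 // oddX /= orbF; lia.
Qed.

Lemma wp_incr Q i n m h lo v j p w u x y c k inp out t :
  (forall v x t', t' <= t + (h * 20 + 10) ->
     Q (stt n m h lo (lo + h) v j p w u x y (2 ^ h %| i.+1) k inp
          (asg lo h i.+1) out) t') ->
  wp incr Q
    (stt n m h lo (lo + h) v j p w u x y c k inp (asg lo h i) out) t.
Proof.
move=> q; rewrite /stt /incr; do 4 wp_step.
apply: (wp_while (N := h) (I := fun r s t' => t' <= t + r * 20 + 5 /\ exists x,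
  s = stt n m h lo (lo + h) (lo + r) j p w u x y (2 ^ r %| i.+1) k inp
    (fun v => if lo <= v < lo + r then nat_of_bool (bit i.+1 (v - lo))
              else asg lo h i v) out)).
- move=> r s t1 rh [le_t [x1 ->]].
  split; first by rewrite eval_test_mk /= ltn_add2l rh.
  pose G r v := if lo <= v < lo + r then nat_of_bool (bit i.+1 (v - lo))
                else asg lo h i v.
  have Gr : G r (lo + r) = bit i r.
    rewrite /G ltnn andbF /asg leq_addr ltn_add2l rh addKn //.
  (* [GS] covers the rounds that write a digit, [GS'] those in which the carry has died out and the
     digit stays. *)
  have GS b : nat_of_bool (bit i.+1 r) = b -> upd (G r) (lo + r) b = G r.+1.
    move=> <-; apply: funext => v1; rewrite /upd /G.
    case: eqP => [->|ne]; first by rewrite addKn; case: ifP => //; lia.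
    by do 2 case: ifP => //; lia.
  have GS' : bit i.+1 r = bit i r -> G r = G r.+1.
    move=> E; rewrite -(GS (bit i r)) ?E //; apply: funext => v1.
    by rewrite /upd; case: eqP => // ->.
  rewrite -/(G r) -/(G r.+1) /stt (addnS lo r) dvdn_exp2S.
  have E := bitS i r.
  wp_run; (split; [by lia | exists (if 2 ^ r %| i.+1 then nat_of_bool (bit i r) else x1)]);
    repeat match goal with
      | H : is_true (_ == 1) |- _ => move: H | H : (_ == 1) = _ |- _ => move: H
    end;
    rewrite ?Gr; case: (2 ^ r %| i.+1) E => //=;
    case B: (bit i r) => //= E *; by rewrite ?(GS 0) ?(GS 1) ?GS' ?E ?B.
- move=> s t1 [le_t [x1 ->]]; split; first by rewrite eval_test_mk /= ltnn.
  have := q (lo + h) x1 t1.+1; rewrite /stt.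
  rewrite (_ : (fun _ => _) = asg lo h i.+1); first by apply; lia.
  by apply: funext => v1; rewrite /asg; case: (lo <= v1 < lo + h).
- split; first by lia.
  exists x; rewrite /stt dvd1n addn0; congr mk; apply: funext => v1.
  by case: ifP => //; lia.
Qed.

Definition vectors (inp : nat -> nat) (n m : nat) (f : bool) (lo h N : nat) :=
  flatten [seq ov_row inp (asg lo h i) n m f | i <- iota 0 N].

Lemma size_ov_row inp g n m f : size (ov_row inp g n m f) = m.+1.
Proof. by rewrite size_rcons size_map size_iota. Qed.

Lemma vectorsS inp n m f lo h N :
  vectors inp n m f lo h N.+1
  = vectors inp n m f lo h N ++ ov_row inp (asg lo h N) n m f.
Proof. by rewrite /vectors -addn1 iotaD map_cat flatten_cat /= cats0. Qed.

Lemma size_vectors inp n m f lo h N :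
  size (vectors inp n m f lo h N) = N * m.+1.
Proof.
by elim: N => // N IH; rewrite vectorsS size_cat IH size_ov_row addnC.
Qed.

Lemma wp_emit_list f Q n m h lo v j p w u x y c k inp out t :
  (forall v j p u x y t',
     t' <= t + 2 ^ h * (m * (n * 30 + 20) + h * 20 + 40) + 10 ->
     Q (stt n m h lo (lo + h) v j p (w + 2 ^ h * m.+1) u x y 1 (2 ^ h) inp
          (asg lo h 0) (put out w (vectors inp n m f lo h (2 ^ h)))) t') ->
  wp (emit_list f) Q
    (stt n m h lo (lo + h) v j p w u x y c k inp (asg lo h 0) out) t.
Proof.
move=> q; rewrite /emit_list /stt; do 4 wp_step.
have N0 : 0 < 2 ^ h by rewrite expn_gt0.
apply: (wp_while (N := 2 ^ h) (I := fun i s t' =>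
  t' <= t + i * (m * (n * 30 + 20) + h * 20 + 40) + 5 /\ exists v j p u x y,
  s = stt n m h lo (lo + h) v j p (w + i * m.+1) u x y (i == 2 ^ h) i inp
    (asg lo h i) (put out w (vectors inp n m f lo h i)))).
- move=> i s t1 iN [le_t [v1 [j1 [p1 [u1 [x1 [y1 ->]]]]]]].
  split; first by rewrite eval_test_mk /= (ltn_eqF iN).
  rewrite /stt; wp_step; apply: wp_emit => v2 j2 p2 u2 x2 y2 t2 le_t2.
  rewrite /stt; do 2 wp_step; apply: wp_incr => v3 x3 t3 le_t3.
  split; first by lia.
  exists v3, j2, p2, u2, x3, y2; congr stt.
  + by rewrite mulSn; lia.
  (* As [i + 1] is at most [2 ^ h], the counter overflows only at the last vector. *)
  + congr nat_of_bool; apply/idP/eqP => [/dvdn_leq|->//]; lia.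
  + by rewrite vectorsS -put_cat size_vectors.
- move=> s t1 [le_t [v1 [j1 [p1 [u1 [x1 [y1 ->]]]]]]].
  split; first by rewrite eval_test_mk /= eqxx.
  by rewrite eqxx asg_period; apply: q; lia.
- split; first by lia.
  by exists v, j, p, u, x, y; rewrite /stt addn0 put0 (ltn_eqF N0).
Qed.

(** The loop bound sits in one of the registers 0 to 7, which the loop does not change; the lemma
    thus serves both bounds [h] and [2h]. *)
Lemma wp_fill y b Q n m h lo hi a j p w u z y' c k inp g out t :
  a <= b ->
  y < 8 -> nth 0 [:: 0; 1; n; m; h; h.*2; lo; hi] y = b ->
  (forall t', t' <= t + (b - a) * 10 + 1 ->
     Q (stt n m h lo hi b j p w u z y' c k inp
          (fun v => if a <= v < b then z else g v) out) t') ->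
  wp (While (TLt 8 y) fill) Q (stt n m h lo hi a j p w u z y' c k inp g out) t.
Proof.
move=> ab y8 yb q.
have yE v : nth 0 [:: 0; 1; n; m; h; h.*2; lo; hi; v; j; p; w; u; z; y'; c; k] y = b.
  by move: y yb y8 {q}; do 8 case=> //.
apply: (wp_while (N := b - a) (I := fun i s t' =>
  t' <= t + i * 10 /\
  s = stt n m h lo hi (a + i) j p w u z y' c k inp
        (fun v => if a <= v < a + i then z else g v) out)).
- move=> i s t1 iN [le_t ->]; split.
    by rewrite eval_test_mk /test_on yE /=; lia.
  rewrite /stt /fill (addnS a i); wp_run; split; first by lia.
  congr mk; apply: funext => v; rewrite /upd.
  by case: eqP => [->|ne]; do ? case: ifP => //; lia.
- move=> s t1 [le_t ->]; split.
    by rewrite eval_test_mk /test_on yE /=; lia.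
  by rewrite subnKC //; apply: q; lia.
- split; first by lia.
  rewrite /stt addn0; congr mk; apply: funext => v; case: ifP => //; lia.
Qed.

(** Cells beyond the new instance still hold the old input here; that they are blank is obtained
    later by comparing lengths. *)
Lemma wp_prep f n m inp Q :
  let h := uphalf n in let N := 2 ^ h in
  inp 0 = n -> inp 1 = m ->
  (forall s t, t <= 400 * (N * n.+1 * m.+1) ->
     (forall k, arrs s 0 k =
        if k < 2 + (N * m.+1).*2
        then nth 0 [:: N, m.+1 & vectors inp n m f 0 h N ++ vectors inp n m f h h N] k
        else inp k) ->
     Q s t) ->
  wp (prep f) Q (mk (nseq 17 0) inp (fun=> 0) (fun=> 0)) 0.
Proof.
move=> h N inp0 inp1 q; rewrite /prep; cbn [nseq ncons iter].
do 7 wp_step; rewrite inp0 inp1.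
apply: (wp_while (N := h) (I := fun i s t => t <= i * 10 + 10 /\
  s = mk [:: 0; 1; n; m; i; 0; 0; 0; i.*2; 0; 0; 0; 0; 0; 0; 0; 0] inp
         (fun=> 0) (fun=> 0))); last by split.
  move=> i s t ih [le_t ->]; split.
    by rewrite eval_test_mk /=; move: ih; rewrite /h; lia.
  by wp_run; split; [lia | rewrite doubleS].
move=> _ t [le_t ->]; split.
  by rewrite eval_test_mk /= -leqNgt /h; lia.
do 9 wp_step; rewrite -[mk _ _ _ _]/(stt n m h 0 0 h 0 0 2 0 2 0 0 0 inp _ _).
apply: (@wp_fill 5 h.*2) => //; first by lia.
move=> t1 le_t1; rewrite /stt; do 5 wp_step.
rewrite -[mk _ _ _ _]/(stt n m h 0 (0 + h) h.*2 0 0 2 0 2 0 0 0 inp _ _).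
rewrite (_ : (fun v => if _ then _ else _) = asg 0 h 0); last first.
  apply: funext => v; rewrite /asg /bit div0n /=.
  by do ? case: ifP => //; lia.
apply: wp_emit_list => v2 j2 p2 u2 x2 y2 t2 le_t2; rewrite /stt; do 5 wp_step.
rewrite -[mk _ _ _ _]/(stt n m h 0 (0 + h) 0 j2 p2 _ u2 2 y2 1 _ inp _ _).
apply: (@wp_fill 4 h) => //.
move=> t3 le_t3; rewrite /stt; do 3 wp_step.
rewrite -[mk _ _ _ _]/(stt n m h 0 (0 + h) h j2 p2 _ u2 0 y2 1 _ inp _ _).
apply: (@wp_fill 5 h.*2) => //; first by lia.
move=> t4 le_t4; rewrite /stt; do 5 wp_step.
rewrite -[mk _ _ _ _]/(stt n m h h h.*2 h.*2 j2 p2 _ u2 0 y2 1 _ inp _ _).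
rewrite -[in stt _ _ _ _ h.*2]addnn.
rewrite (_ : (fun v => if _ then _ else _) = asg h h 0); last first.
  apply: funext => v; rewrite /asg /bit !div0n /=.
  by do ? case: ifP => //; lia.
apply: wp_emit_list => v5 j5 p5 u5 x5 y5 t5 le_t5; rewrite /stt; do 8 wp_step.
rewrite -/N in le_t2 le_t5 *.
set w := 2 + N * m.+1 + N * m.+1.
set F := upd (upd _ 0 N) 1 m.+1.
have FE k : k < w -> F k = nth 0
    [:: N, m.+1 & vectors inp n m f 0 h N ++ vectors inp n m f h h N] k.
  rewrite /F /w => kw.
  have -> : 2 + N * m.+1 = 2 + size (vectors inp n m f 0 h N) by rewrite size_vectors.
  rewrite put_cat; case: k kw => [|[|k]] //= kw.
  by rewrite /upd /put /= size_cat !size_vectors subn2 /= ifT //; lia.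
clearbody F.
apply: (wp_while (N := w) (I := fun i s t => t <= t5 + i * 10 + 20 /\ exists x,
  s = mk [:: 0; 1; n; m.+1; h; h.*2; h; h + h; i; j5; p5; w; u5; x; y5; 1; N]
   (fun k => if k < i then F k else inp k) (asg h h 0) F)).
- move=> i s t6 iw [le_t6 [x ->]]; split; first by rewrite eval_test_mk.
  wp_run; split; first by lia.
  exists (F i); congr mk; apply: funext => k; rewrite /upd.
  by case: eqP => [->|ne]; do ? case: ifP => //; lia.
- move=> s t6 [le_t6 [x ->]]; split; first by rewrite eval_test_mk /= ltnn.
  apply: q => [|k /=].
    have N0 : 0 < N by rewrite expn_gt0.
    have hn : N * h <= N * n by rewrite leq_mul2l /h; lia.
    have hN : h <= N * h by rewrite leq_pmull.
    by rewrite /w in le_t6; lia.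
  rewrite (_ : 2 + (N * m.+1).*2 = w); last by rewrite /w; lia.
  by case: ifP => // /FE.
- split; first by lia.
  by exists x5; congr mk; apply: funext.
Qed.

(** * Encodings of formulas and of vectors *)

Lemma nth_flatten_uniform (T : Type) (x : T) b (ss : seq (seq T)) j r :
  all (fun s => size s == b) ss -> r < b ->
  nth x (flatten ss) (j * b + r) = nth x (nth [::] ss j) r.
Proof.
elim: ss j => [|s ss IH] j; first by rewrite /= !nth_nil.
move=> /= /andP[/eqP sb ssb] rb; rewrite nth_cat sb.
case: j => [|j] /=; first by rewrite rb.
by rewrite mulSn -addnA ltnNge leq_addr addKn IH.
Qed.

Lemma size_flatten_uniform (T : Type) b (ss : seq (seq T)) :
  all (fun s => size s == b) ss -> size (flatten ss) = size ss * b.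
Proof.
by elim: ss => //= s ss IH /andP[/eqP sb /IH E]; rewrite size_cat sb E mulSn.
Qed.

Lemma size_encode_clause n (cl : {set 'I_n * bool}) :
  size (encode_clause cl) = n.*2.
Proof.
rewrite /encode_clause (@size_flatten_uniform _ 2).
  by rewrite size_map -cardE card_ord muln2.
by rewrite all_map; apply/allP.
Qed.

Lemma size_encode_cnf phi :
  size (encode_cnf phi) = 2 + (cnf_size phi * cnf_vars phi).*2.
Proof.
rewrite /= (@size_flatten_uniform _ (cnf_vars phi).*2).
  by rewrite size_map size_tuple doubleMr.
by rewrite all_map; apply/allP => cl _ /=; rewrite size_encode_clause.
Qed.

Lemma nth_encode_cnf phi (j : 'I_(cnf_size phi)) (v : 'I_(cnf_vars phi)) (b : bool) :
  nth 0 (encode_cnf phi) (2 + (cnf_vars phi * j).*2 + v.*2 + b)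
  = ((v, ~~ b) \in tnth (clauses phi) j).
Proof.
rewrite /encode_cnf -!addnA add2n /= mulnC doubleMr nth_flatten_uniform; last first.
- by have := ltn_ord v; lia.
- by rewrite all_map; apply/allP => cl _ /=; rewrite size_encode_clause.
rewrite (nth_map set0) ?size_tuple // -tnth_nth /encode_clause -muln2.
rewrite nth_flatten_uniform; last first.
- by case: b.
- by rewrite all_map; apply/allP.
by rewrite (nth_map v) ?size_enum_ord // nth_ord_enum; case: b.
Qed.

Definition entry (inp g : nat -> nat) (n m : nat) (f : bool) (k : nat) : bool :=
  if k < m then unsat inp g n (2 + (n * k).*2) else f && (g n != 0).

Lemma ov_rowE inp g n m f :
  ov_row inp g n m f = [seq nat_of_bool (entry inp g n m f k) | k <- iota 0 m.+1].
Proof.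
rewrite -addn1 iotaD map_cat cats1 /ov_row /entry /= ltnn; congr rcons.
by apply/eq_in_map => k; rewrite mem_iota => /andP[_ ->].
Qed.

Lemma encode_mx_nat N d (F : nat -> nat -> bool) :
  encode_mx (\matrix_(i < N, k < d) F i k)
  = flatten [seq [seq nat_of_bool (F i k) | k <- iota 0 d] | i <- iota 0 N].
Proof.
rewrite /encode_mx -!val_enum_ord -map_comp; congr flatten.
apply: eq_map => i /=; rewrite -map_comp; apply: eq_map => k /=.
by rewrite mxE.
Qed.

Definition half_matrix (phi : cnf) (f : bool) (lo : nat) :=
  let n := cnf_vars phi in let h := uphalf n in
  (\matrix_(i < 2 ^ h, k < (cnf_size phi).+1)
    entry (nth 0 (encode_cnf phi)) (asg lo h i) n (cnf_size phi) f k)%R.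

Definition cnf_ov (phi : cnf) (f : bool) : ov :=
  OV (half_matrix phi f 0) (half_matrix phi f (uphalf (cnf_vars phi))).

Lemma encode_cnf_ov phi f :
  let n := cnf_vars phi in let m := cnf_size phi in let h := uphalf n in
  let inp := nth 0 (encode_cnf phi) in
  encode_ov (cnf_ov phi f)
  = [:: 2 ^ h, m.+1 & vectors inp n m f 0 h (2 ^ h) ++ vectors inp n m f h h (2 ^ h)].
Proof.
move=> n m h inp.
have E lo : encode_mx (half_matrix phi f lo) = vectors inp n m f lo h (2 ^ h).
  rewrite (encode_mx_nat _ _ (fun i => entry inp (asg lo h i) n m f)).
  by congr flatten; apply: eq_map => i; rewrite ov_rowE.
by rewrite /encode_ov /= !E.
Qed.

(** * Orthogonal pairs and satisfying assignments *)

Lemma bit_inj h i j : i < 2 ^ h -> j < 2 ^ h ->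
  (forall u, u < h -> bit i u = bit j u) -> i = j.
Proof.
elim: h i j => [|h IH] i j; first by rewrite expn0; lia.
rewrite expnS => ih jh E.
have b0 k : bit k 0 = odd k by rewrite /bit divn1.
have bS k u : bit k u.+1 = bit k./2 u by rewrite /bit expnS divnMA divn2.
have /IH: i./2 < 2 ^ h by lia.
move=> /(_ j./2) hij; have := E 0 isT; rewrite !b0 => oij.
rewrite -(odd_double_half i) -(odd_double_half j) oij hij //; first lia.
by move=> u uh; rewrite -!bS E.
Qed.

Definition pair_bit (h i j v : nat) : bool :=
  if v < h then bit i v else bit j (v - h).

(** A product of two entries vanishes iff one of the halves satisfies the clause, that is, iff the
    joint assignment does. The last coordinate tests the dummy bits, of which there is at most one
    since [n <= 2h <= n + 1]. *)
Lemma orth_sat phi f (i j : 'I_(2 ^ uphalf (cnf_vars phi))) :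
  let n := cnf_vars phi in let h := uphalf n in
  (inner (half_matrix phi f 0) (half_matrix phi f h) i j == 0)
  = @satisfies phi [ffun v : 'I_n => pair_bit h i j v]
    && (f ==> [forall v : 'I_(h.*2 - n), ~~ pair_bit h i j (n + v)]).
Proof.
move=> n h; set m := cnf_size phi; set inp := nth 0 (encode_cnf phi).
pose ent lo i k := entry inp (asg lo h i) n m f k.
have nh : n <= h.*2 <= n.+1 by rewrite /h; lia.
have -> : (inner (half_matrix phi f 0) (half_matrix phi f h) i j == 0)
    = [forall k : 'I_m.+1, ~~ (ent 0 i k && ent h j k)].
  rewrite /inner sum_nat_eq0; apply: eq_forallb => k.
  rewrite !mxE -/n -/h -/m -/inp -/(ent 0 i k) -/(ent h j k).
  by case: (ent 0 i k); case: (ent h j k).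
(* Let [f] hold. For odd [n] the first vector sees the value 2 at position [n], so its entry is 1
   and the product is the dummy bit supplied by [j]. For even [n] both entries are 0 and there is no
   dummy bit. *)
have last : ~~ (ent 0 i m && ent h j m)
    = (f ==> [forall v : 'I_(h.*2 - n), ~~ pair_bit h i j (n + v)]).
  rewrite /ent /entry ltnn; case: f {ent} => //=.
  apply/idP/forallP => [H v|H].
    have := ltn_ord v => vh.
    move: H; rewrite /asg /pair_bit.
    by do ! case: ifP => //=; try lia; rewrite (_ : n + v = n); lia.
  have [n2h|n2h] := eqVneq n h.*2.
    by rewrite /asg !ifF ?andbF //; lia.
  have v0 : 0 < h.*2 - n by lia.
  have := H (Ordinal v0); rewrite /asg /pair_bit addn0 ifF; last by lia.
  have -> : h <= n < h + h by lia.
  by move=> /negbTE ->; rewrite andbF.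
have clauseE (k : 'I_m) : ~~ (ent 0 i k && ent h j k)
    = [exists l in tnth (clauses phi) k,
         [ffun v : 'I_n => pair_bit h i j v] l.1 == l.2].
  have unsatE g : unsat inp g n (2 + (n * k).*2) = ~~ [exists v : 'I_n,
      ((v, true) \in tnth (clauses phi) k) && (g v == 1)
      || ((v, false) \in tnth (clauses phi) k) && (g v == 0)].
    rewrite /unsat; congr negb.
    have E (v : 'I_n) : satisfied_by inp g (2 + (n * k).*2) v
        = ((v, true) \in tnth (clauses phi) k) && (g v == 1)
          || ((v, false) \in tnth (clauses phi) k) && (g v == 0).
      have := nth_encode_cnf k v false; have := nth_encode_cnf k v true.
      rewrite addn0 addn1 /satisfied_by -/n -/inp => -> -> /=.
      by case: (_ \in _); case: (_ \in _).
    apply/hasP/existsP => [[v]|[v vE]].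
      by rewrite mem_iota => vn vE; exists (Ordinal vn); rewrite -E.
    by exists (val v); [rewrite mem_iota ltn_ord | rewrite E].
  rewrite /ent /entry ltn_ord !unsatE -negb_or negbK.
  (* Each vector reacts to its own half only, as the variables of the other half read 2. *)
  have gA v : v < n -> asg 0 h i v = if v < h then nat_of_bool (bit i v) else 2.
    by move=> vn; rewrite /asg add0n subn0 /=; do ! case: ifP => //; lia.
  have gB v : v < n -> asg h h j v = if v < h then 2 else nat_of_bool (bit j (v - h)).
    by move=> vn; rewrite /asg /=; do ! case: ifP => //; lia.
  apply/orP/existsP => [[]/existsP[v]|[[v b] /= /andP[vb]]].
  - rewrite gA //; case: ifP => vh; last by rewrite !andbF.
    case/orP=> /andP[vl bv]; [exists (v, true) | exists (v, false)];
    by rewrite vl ffunE /pair_bit vh; case: bit bv.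
  - rewrite gB //; case: ifP => vh; first by rewrite !andbF.
    case/orP=> /andP[vl bv]; [exists (v, true) | exists (v, false)];
    by rewrite vl ffunE /pair_bit vh; case: bit bv.
  - rewrite ffunE /pair_bit; case: ifP => vh /eqP E.
      left; apply/existsP; exists v; rewrite gA // vh E.
      by case: b vb {E} => -> //=; rewrite orbT.
    right; apply/existsP; exists v; rewrite gB // vh E.
    by case: b vb {E} => -> //=; rewrite orbT.
apply/forallP/andP => [H|[/forallP s e] k].
  split; last by rewrite -last; exact: H ord_max.
  by apply/forallP => k; rewrite -clauseE; exact: (H (widen_ord (leqnSn m) k)).
have [km|] := ltnP k m; first by have := s (Ordinal km); rewrite -clauseE.
have := ltn_ord k; rewrite ltnS => km mk; rewrite (_ : k = m :> nat) ?last //.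
by lia.
Qed.

(** Pairs of indices correspond bijectively to assignments of the [n] variables together with
    [d = 2h - n] dummy bits. By [orth_sat], orthogonality makes the dummy bits false (factor 1) or
    leaves them free (factor [2 ^ d]). *)
Lemma num_orth_cnf_ov phi f :
  let n := cnf_vars phi in
  num_orth (cnf_ov phi f)
  = num_sat phi * (if f then 1 else 2 ^ ((uphalf n).*2 - n)).
Proof.
move=> n; set h := uphalf n; set d := h.*2 - n.
have nh : n <= h.*2 by rewrite /h; lia.
pose Phi (ij : 'I_(2 ^ h) * 'I_(2 ^ h)) :
    {ffun 'I_n -> bool} * {ffun 'I_d -> bool} :=
  ([ffun v : 'I_n => pair_bit h ij.1 ij.2 v],
   [ffun v : 'I_d => pair_bit h ij.1 ij.2 (n + v)]).
have PhiE ij ij' v : Phi ij = Phi ij' -> v < h.*2 ->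
    pair_bit h ij.1 ij.2 v = pair_bit h ij'.1 ij'.2 v.
  move=> [/ffunP E1 /ffunP E2] vh; have [vn|nv] := ltnP v n.
    by have := E1 (Ordinal vn); rewrite !ffunE.
  have vd : v - n < d by rewrite /d; lia.
  by have := E2 (Ordinal vd); rewrite !ffunE /= subnKC.
have Phi_inj : injective Phi.
  move=> [i j] [i' j'] E; congr (_, _); apply: val_inj.
    apply: (bit_inj (ltn_ord _) (ltn_ord _)) => u uh.
    by have := PhiE _ _ u E; rewrite /pair_bit uh => -> //; lia.
  apply: (bit_inj (ltn_ord _) (ltn_ord _)) => u uh.
  have := PhiE _ _ (h + u) E; rewrite /pair_bit addKn.
  have -> : (h + u < h) = false by lia.
  by apply; lia.
have Phi_bij : bijective Phi.
  apply: inj_card_bij => //; rewrite !card_prod !card_ffun !card_bool !card_ord.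
  by rewrite -!expnD leq_exp2l // /d; lia.
pose S := setX [set a | @satisfies phi a]
  (if f then [set [ffun=> false]] else [set: {ffun 'I_d -> bool}]).
have -> : num_orth (cnf_ov phi f) = #|Phi @^-1: S|.
  rewrite /num_orth; apply: eq_card => ij; rewrite !inE orth_sat /= -/n -/h -/d.
  congr andb; case: (f); rewrite ?inE //=.
  apply/forallP/eqP => [H|/ffunP H v].
    by apply/ffunP => v; rewrite !ffunE; apply: negbTE.
  by have := H v; rewrite !ffunE => ->.
rewrite on_card_preimset; last exact: onW_bij.
rewrite cardsX; congr muln; case: (f); first by rewrite cards1.
by rewrite cardsT card_ffun card_bool card_ord.
Qed.

(** * The reduction as a program *)

Lemma double_leq_exp2 h : h.*2 <= 2 ^ h.
Proof. by case: h => // h; rewrite expnS mul2n leq_double ltn_expl. Qed.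

Lemma exec_prep phi f :
  let n := cnf_vars phi in
  exists s t, [/\ exec (prep f) (init_store (encode_cnf phi)) s t,
    t <= 400 * (2 ^ uphalf n * n.+1 * (cnf_size phi).+1)
    & forall k, arrs s 0 k = nth 0 (encode_ov (cnf_ov phi f)) k].
Proof.
move=> n; set m := cnf_size phi; set h := uphalf n.
pose inp := nth 0 (encode_cnf phi).
have -> : init_store (encode_cnf phi) = mk (nseq 17 0) inp (fun=> 0) (fun=> 0).
  rewrite /init_store /mk; congr Store; apply: funext.
    by move=> x; rewrite nth_nseq if_same.
  by case=> [|[|[|a]]].
suff : wp (prep f) (fun s t => t <= 400 * (2 ^ h * n.+1 * m.+1) /\
    forall k, arrs s 0 k = nth 0 (encode_ov (cnf_ov phi f)) k)
    (mk (nseq 17 0) inp (fun=> 0) (fun=> 0)) 0.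
  by case=> s [t [E [le_t arrE]]]; exists s, t.
apply: (@wp_prep f n m) => // s t le_t arrE; split=> // k.
rewrite arrE encode_cnf_ov -/n -/m -/h; case: ltnP => // kge.
rewrite [RHS]nth_default; last by rewrite /= size_cat !size_vectors; lia.
(* The formula occupies [2 + 2mn] cells and [n <= 2h <= 2 ^ h], so the new instance covers it
   entirely. *)
apply: nth_default; apply: leq_trans kge; rewrite size_encode_cnf.
rewrite leq_add2l leq_double -/n -/m mulnC.
apply: leq_mul (leqnSn m); apply: leq_trans (double_leq_exp2 h).
by rewrite /h; lia.
Qed.

Lemma ov_reduction (R : realType) (p : cmd) (f : bool) :
  exists q : cmd, forall phi : cnf, exists2 T : nat,
    T <= 400 * (2 ^ uphalf (cnf_vars phi) * (cnf_vars phi).+1 * (cnf_size phi).+1) + 1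
    & forall t E, prob R q (encode_cnf phi) (T + t) E
                  = prob R p (encode_ov (cnf_ov phi f)) t E.
Proof.
(* Adding 2 puts the output registers, variable 0 and array 1, below [V]. *)
have [V0 p0] := ex_below p; pose V := V0 + 2.
have pV : below V V p by apply: belowW p0; rewrite leq_addr.
have V0' : 0 < V by rewrite /V addn2.
have V1 : 1 < V by rewrite /V addn2.
exists (rename V V (prep f) ;; p) => phi.
have [s [t [E le_t arrE]]] := exec_prep phi f.
have [s' [lo _ la ar] H] :=
  run_rename R V0' E (embeds_init V (encode_cnf phi) V0').
(* The extra unit is the unfolding of the sequence. *)
exists (1 + t) => [|u P]; first by rewrite add1n addn1 ltnS.
apply: prob_sim V0' V1 _ _.
  rewrite -[run _ _]/(run_all _ [:: _]) run_all_add.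
  exact: H.
split; rewrite /= ?pV ?addn0 ?add1n //.
split=> [x xV|a i aV] /=; first exact: lo.
case: eqP => [->|/eqP a0]; first by rewrite (ar 0) arrE.
by rewrite la // lt0n a0.
Qed.

(** There are [2 ^ h] vectors, with logarithm [h]. Squaring [n <= 2(h + 1)] produces the factor 4;
    the added 2 absorbs the last coordinate and keeps the exponent at least 2. *)
Lemma polylog_dim_cnf_ov c phi f : cnf_size phi <= c * cnf_vars phi ^ 2 ->
  polylog_dim (4 * c + 2) (cnf_ov phi f).
Proof.
rewrite /polylog_dim /= trunc_expnK // => le_m; set n := cnf_vars phi in le_m *.
have nh : n <= 2 * (uphalf n).+1 by lia.
have : c * n ^ 2 <= c * (2 * (uphalf n).+1) ^ 2 by rewrite leq_mul2l leq_sqr nh orbT.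
set h := (uphalf n).+1 in nh *; rewrite expnMn => le_c.
have : (4 * c + 2) * h ^ 2 <= (4 * c + 2) * h ^ (4 * c + 2).
  by rewrite leq_mul2l leq_pexp2l ?orbT //; lia.
by have : 0 < h ^ 2; rewrite ?expn_gt0 //; lia.
Qed.

(** * Estimates for the running time *)

Local Open Scope ring_scope.

(** From [1 + x <= exp x] at [x = (n / k) ln 2], multiplied by [1 + k / ln 2]. *)
Lemma natr_le_powR (R : realType) (k : nat) : (0 < k)%N ->
  exists2 a : R, 0 < a & forall n : nat, n.+1%:R <= a * 2 `^ (n%:R / k%:R).
Proof.
move=> k0; have l0 : 0 < ln 2 :> R by rewrite ln_gt0 // ltr1n.
have k0' : 0 < k%:R :> R by rewrite ltr0n.
exists (1 + k%:R / ln 2) => [|n]; first by rewrite addr_gt0 // divr_gt0.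
have := expR_ge1Dx (n%:R / k%:R * ln 2 : R); rewrite /powR pnatr_eq0 /= => le_e.
apply: (@le_trans _ _ ((1 + k%:R / ln 2) * (1 + n%:R / k%:R * ln 2))); last first.
  by rewrite ler_wpM2l // addr_ge0 // divr_ge0 // ltW.
rewrite mulrDl mul1r mulrDr mulr1 (_ : k%:R / ln 2 * (n%:R / k%:R * ln 2) = n%:R); last first.
  by field; rewrite !gt_eqF.
have : 0 <= n%:R / k%:R * ln 2 :> R by rewrite !mulr_ge0 ?invr_ge0 // ltW.
have : 0 <= k%:R / ln 2 :> R by rewrite divr_ge0 // ltW.
by rewrite -natr1; lra.
Qed.

Lemma exp2_uphalf_powR (R : realType) n :
  ((2 ^ uphalf n)%N%:R : R) <= 2 * 2 `^ (n%:R / 2).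
Proof.
have -> : 2 * 2 `^ (n%:R / 2) = 2 `^ (1 + n%:R / 2) :> R.
  by rewrite powRD ?powRr1 // pnatr_eq0 implybT.
rewrite natrX -powR_mulrn // ler_powR ?ler1n // -(@ler_pM2r _ 2) //.
rewrite mulrDl mul1r divfK ?pnatr_eq0 // -natrM -natrD ler_nat; lia.
Qed.

(** Since [h <= (n + 1) / 2] and [4e <= delta], the exponent [h(2 - delta)] is at most
    [(n + 1)(1 - 2e)], hence at most [1 + n(1 - e)]. *)
Lemma ov_time_le (R : realType) (delta e : R) n :
  0 <= e -> 4 * e <= delta -> 4 * e <= 1 ->
  ((2 ^ uphalf n)%N%:R `^ (2 - delta) : R) <= 2 * 2 `^ (n%:R * (1 - e)).
Proof.
move=> e0 ed e1.
have -> : 2 * 2 `^ (n%:R * (1 - e)) = 2 `^ (1 + n%:R * (1 - e)) :> R.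
  by rewrite powRD ?powRr1 // pnatr_eq0 implybT.
rewrite natrX -powR_mulrn // -powRrM ler_powR ?ler1n //.
have h2 : (uphalf n)%:R * 2 <= n%:R + 1 :> R by rewrite -natrM natr1 ler_nat; lia.
have n0 : 0 <= n%:R :> R by [].
have h0 : 0 <= (uphalf n)%:R :> R by [].
apply: (@le_trans _ _ ((uphalf n)%:R * (2 - 4 * e))); first by rewrite ler_wpM2l //; lra.
by nra.
Qed.

Lemma prep_time_le (R : realType) (c : nat) (e : R) :
  4 * e <= 1 -> exists2 C : R, 0 < C & forall n m : nat,
    (m <= c * n ^ 2)%N ->
    (400 * (2 ^ uphalf n * n.+1 * m.+1) + 1)%N%:R <= C * 2 `^ (n%:R * (1 - e)).
Proof.
(* As [m + 1 <= (c + 1)(n + 1)^2], three factors [n + 1] occur. At the price [2 ^ (n/12)] each they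
   cost [2 ^ (n/4)]; with [2 ^ (n/2)] vectors this gives [2 ^ (3n/4)], which suffices as
   [e <= 1/4]. *)
move=> e1; have [//|a a0 aE] := @natr_le_powR R 12.
exists ((400 * c.+1 + 1)%N%:R * (2 * a ^+ 3)) => [|n m le_m].
  by rewrite !mulr_gt0 ?exprn_gt0 // ltr0n.
apply: (@le_trans _ _ ((400 * c.+1 + 1) * (2 ^ uphalf n * n.+1 ^ 3))%N%:R).
  rewrite ler_nat; set N := (2 ^ _)%N.
  have N0 : (0 < N)%N by rewrite expn_gt0.
  have m1 : (m.+1 <= c.+1 * n.+1 ^ 2)%N.
    apply: (@leq_trans (c * n ^ 2 + n.+1 ^ 2)); first by rewrite -addn1 leq_add // expn_gt0.
    by rewrite mulSn addnC leq_add2l leq_mul2l leq_sqr leqnSn orbT.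
  have le1 : (N * n.+1 * m.+1 <= N * n.+1 * (c.+1 * n.+1 ^ 2))%N by rewrite leq_mul2l m1 orbT.
  have le2 : (0 < N * n.+1 ^ 3)%N by rewrite muln_gt0 N0 expn_gt0.
  have E : (N * n.+1 * (c.+1 * n.+1 ^ 2) = c.+1 * (N * n.+1 ^ 3))%N by ring.
  by rewrite E in le1; lia.
rewrite natrM -mulrA ler_wpM2l // natrM (natrX _ _ 3).
have le3 : n.+1%:R ^+ 3 <= a ^+ 3 * 2 `^ (n%:R / 4) :> R.
  have -> : 2 `^ (n%:R / 4) = (2 `^ (n%:R / 12)) ^+ 3 :> R.
    by rewrite -powR_mulrn ?powR_ge0 // -powRrM; congr powR; field.
  by rewrite -exprMn lerXn2r ?nnegrE // mulr_ge0 ?powR_ge0 // ltW.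
apply: (le_trans (ler_pM _ _ (exp2_uphalf_powR R n) le3)) => //; first exact: exprn_ge0.
rewrite mulrACA -powRD ?pnatr_eq0 ?implybT // ler_wpM2l //.
  by rewrite mulr_ge0 // exprn_ge0 // ltW.
rewrite ler_powR ?ler1n //.
have n0 : 0 <= n%:R :> R by [].
by nra.
Qed.

(** * Transfer of the hardness hypotheses *)

Lemma no_fast_ov (R : realType) (delta : R) (sat_ans : cnf -> nat)
    (ov_ans : ov -> nat) (f : bool) :
  0 < delta -> (forall phi, ov_ans (cnf_ov phi f) = sat_ans phi) ->
  QSETH_for R sat_ans -> ~ exists p, solves_OV_in_time p ov_ans delta.
Proof.
move=> d0 ansE hard [p [p_solves p_time]].
(* The bound [4e <= delta] serves the OV program, and [4e <= 1] the preprocessing. *)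
pose e : R := Num.min delta 1 / 4.
have e0 : 0 < e by rewrite divr_gt0 // lt_min d0 ltr01.
have [ed e1] : 4 * e <= delta /\ 4 * e <= 1.
  by rewrite mulrC divfK ?pnatr_eq0 // !ge_min !lexx orbT.
have [c [c0]] := hard e e0; apply.
have [q qE] := ov_reduction R p f; exists q; split.
  move=> phi _; have [T _ qT] := qE phi.
  have [t [p_halts p_correct]] := p_solves (cnf_ov phi f) I.
  exists (T + t)%N; rewrite /halts_within !qT; split=> //.
  by move: p_correct; rewrite /= ansE.
pose k := Num.bound c.
have few phi : (cnf_size phi)%:R <= c * (cnf_vars phi)%:R ^+ 2 ->
    (cnf_size phi <= k * cnf_vars phi ^ 2)%N.
  move=> H; rewrite -(ler_nat R) (le_trans H) // natrM natrX ler_wpM2r ?exprn_ge0 //.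
  by rewrite ltW // archi_boundP // ltW.
have [C [n0 p_bound]] := p_time (4 * k + 2)%N.
have [C' C'0 prep_bound] := prep_time_le k e1.
(* The absolute value is there because [C] may be negative; the 2 comes from rounding [n/2] up. The
   threshold [n0] carries over because the OV instance has [2 ^ h >= n] vectors. *)
exists (C' + `|C| * 2), n0 => phi /few fewphi n0n.
have [t [le_t p_halts]] : exists t : nat,
    t%:R <= C * (2 ^ uphalf (cnf_vars phi))%N%:R `^ (2 - delta) /\
    halts_within R p (encode_ov (cnf_ov phi f)) t.
  apply: (p_bound (cnf_ov phi f)); first exact: polylog_dim_cnf_ov.
  apply: leq_trans n0n _; apply: leq_trans (double_leq_exp2 _); lia.
have [T le_T qT] := qE phi; exists (T + t)%N.
split; last by rewrite /halts_within qT.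
rewrite natrD mulrDl lerD //.
  by apply: le_trans (prep_bound _ _ fewphi); rewrite ler_nat.
apply: (le_trans le_t); rewrite -mulrA.
apply: (@le_trans _ _ (`|C| * (2 ^ uphalf (cnf_vars phi))%N%:R `^ (2 - delta))).
  by rewrite ler_wpM2r ?powR_ge0 // ler_norm.
by rewrite ler_wpM2l // ov_time_le // ltW.
Qed.

Theorem corollary6p8 (R : realType) (delta : R) (hdelta : 0 < delta) :
  (count_QSETH R ->
     ~ exists p : cmd, solves_OV_in_time p (answer count_OV) delta)
  /\ (parity_QSETH R ->
     ~ exists p : cmd, solves_OV_in_time p (answer parity_OV) delta)
  /\ (majority_QSETH R ->
     ~ exists p : cmd, solves_OV_in_time p (answer st_maj_OV) delta).
Proof.
split; last split.
- by apply: (@no_fast_ov _ _ _ _ true) => // phi; rewrite /= num_orth_cnf_ov muln1.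
- by apply: (@no_fast_ov _ _ _ _ true) => // phi; rewrite /= num_orth_cnf_ov muln1.
- move=> [_]; apply: (@no_fast_ov _ _ _ _ false) => // phi /=.
  rewrite num_orth_cnf_ov /= mulnA -expnM muln2; congr nat_of_bool.
  set n := cnf_vars phi; have nh : (n <= (uphalf n).*2)%N by lia.
  (* The squared number of vectors is [2 ^ n] times the factor [2 ^ (2h - n)] of the free dummy
     bits, which cancels on both sides. *)
  by rewrite -{1}(subnKC nh) expnD ltn_pmul2r // expn_gt0.
Qed.
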